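(* Let $\mathbb{S}=(A,\prec)$ be a proto-subordination algebra, with associated maps $\Diamond,\blacksquare$ and structure $\mathbb{S}^*=(A,\Diamond,\blacksquare)$. Then: (i) ${\prec}\subseteq{\leq}$ iff $\mathbb{S}^*\models a\leq\Diamond a$ iff $\mathbb{S}^*\models\blacksquare a\leq a$. (ii) If $\mathbb{S}\models$ (WO)+(DD), then ${\leq}\subseteq{\prec}$ iff $\mathbb{S}^*\models\Diamond a\leq a$. (iii) If $\mathbb{S}\models$ (WO)+(DD)+(SI), then: (a) $\mathbb{S}\models$ (T) iff $\mathbb{S}^*\models\Diamond a\leq\Diamond\Diamond a$; (b) $\mathbb{S}\models$ (D) iff $\mathbb{S}^*\models\Diamond\Diamond a\leq\Diamond a$. (iv) If $\mathbb{S}\models$ (WO)+(DD)+(SI) and $A$ is a meet-semilattice, then: (a) $\mathbb{S}\models$ (CT) iff $\mathbb{S}^*\models\Diamond a\leq\Diamond(a\wedge\Diamond a)$; (b) $\mathbb{S}\models$ (SL2) iff $\mathbb{S}^*\models\Diamond(\Diamond a\wedge\Diamond b)\leq\Diamond(a\wedge b)$. (v) If $\mathbb{S}\models$ (SI), then $\mathbb{S}\models$ (CT) implies $\mathbb{S}\models$ (T). (vi) If $\mathbb{S}$ is directed, i.e. $\mathbb{S}\models$ (SI)+(WO)+(UD)+(DD), and $A$ is endowed with an operation $\neg:A\to A$ which is antitone, involutive ($\neg\neg a=a$), and left or right self-adjoint, then: (a) $\mathbb{S}\models$ (S6) iff $\mathbb{S}^*\models\neg\Diamond a=\blacksquare\neg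 a$ (thus $\blacksquare a=\neg\Diamond\neg a$); (b) $\mathbb{S}\models$ (S6) iff $\mathbb{S}^*\models\Diamond\neg a=\neg\blacksquare a$ (thus $\Diamond a=\neg\blacksquare\neg a$). (vii) If $\mathbb{S}\models$ (SI)+(UD)+(WO) and $A$ is a join-semilattice, then: (a) $\mathbb{S}\models$ (S9$\Rightarrow$) iff $\mathbb{S}^*\models\blacksquare(a\vee\blacksquare b)\leq\blacksquare a\vee\blacksquare b$; (b) $\mathbb{S}\models$ (S9$\Leftarrow$) iff $\mathbb{S}^*\models\blacksquare a\vee\blacksquare b\leq\blacksquare(a\vee\blacksquare b)$; (c) $\mathbb{S}\models$ (SL1) iff $\mathbb{S}^*\models\blacksquare(a\vee b)\leq\blacksquare(\blacksquare a\vee\blacksquare b)$.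
   Context: A proto-subordination algebra is a pair $\mathbb{S}=(A,\prec)$ with $A$ a (possibly bounded) poset and ${\prec}\subseteq A\times A$. Write ${\prec}[a]=\{b\in A\mid a\prec b\}$ and ${\prec}^{-1}[a]=\{b\in A\mid b\prec a\}$. Operations $\wedge,\vee,\neg$ mentioned in a condition are assumed to exist on $A$ (so in (v) the meets occurring in (CT) exist). Conditions on $\prec$ (free variables universally quantified over $A$): (SI) $a\leq b\prec x\Rightarrow a\prec x$. (WO) $b\prec x\leq y\Rightarrow b\prec y$. (DD) $a\prec x_1\ \&\ a\prec x_2\Rightarrow\exists x(a\prec x\ \&\ x\leq x_1\ \&\ x\leq x_2)$. (UD) $a_1\prec x\ \&\ a_2\prec x\Rightarrow\exists a(a\prec x\ \&\ a_1\leq a\ \&\ a_2\leq a)$. (T) $a\prec b\ \&\ b\prec c\Rightarrow a\prec c$. (D) $a\prec c\Rightarrow\exists b(a\prec b\ \&\ b\prec c)$. (CT) $a\prec b\ \&\ a\wedge b\prec c\Rightarrow a\prec c$. (S6) $a\prec b\Rightarrow\neg b\prec\neg a$. (S9$\Rightarrow$) $\exists c(c\prec b\ \&\ x\prec a\vee c)\Rightarrow\exists a'\exists b'(a'\prec a\ \&\ b'\prec b\ \&\ x\leq a'\vee b')$. (S9$\Leftarrow$) the converse implication of (S9$\Rightarrow$). (SL1) $a\prec b\vee c\Rightarrow\exists b'\exists c'(b'\prec b\ \&\ c'\prec c\ \&\ a\prec b'\vee c')$. (SL2) $b\wedge c\prec a\Rightarrow\exists b'\exists c'(b\prec b'\ \&\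 c\prec c'\ \&\ b'\wedge c'\prec a)$. A subset $B\subseteq A$ is down-directed (resp. up-directed) if for all $a,b\in B$ some $x\in B$ exists with $x\leq a$ and $x\leq b$ (resp. $a\leq x$ and $b\leq x$). If $A$ is a subposet of a complete lattice $A'$, an element of $A'$ is closed if it is $\bigwedge F$ for some down-directed $F\subseteq A$, and open if it is $\bigvee I$ for some up-directed $I\subseteq A$. $A$ is dense in $A'$ if every element of $A'$ is both a join of closed elements and a meet of open elements; $A$ is compact in $A'$ if for all down-directed $F\subseteq A$ and up-directed $I\subseteq A$, $\bigwedge F\leq\bigvee I$ implies $a\leq b$ for some $a\in F$, $b\in I$. The canonical extension $A^\delta$ of $A$ is the (unique up to isomorphism fixing $A$) complete lattice containing $A$ as a dense and compact subposet. $K(A^\delta)$ and $O(A^\delta)$ are its sets of closed and open elements. Define $\Diamond,\blacksquare:A\to A^\delta$ by $\Diamond a=\bigwedge{\prec}[a]$ and $\blacksquare a=\bigvee{\prec}^{-1}[a]$ (in $A^\delta$), and $\mathbb{S}^*=(A,\Diamond,\blacksquare)$. These are extended to $A^\delta$ (and the extensions are used to interpret nested modalities) by: for $k\in K(A^\delta)$, $o\in O(A^\delta)$, $u\in A^\delta$, $\Diamond k=\bigwedge\{\Diamond a\mid a\in A,\ k\leq a\}$, $\Diamond u=\bigvee\{\Diamond k\mid k\in K(A^\delta),\ k\leq u\}$, $\blacksquare o=\bigvee\{\blacksquare a\mid a\in A,\ a\leq o\}$, $\blacksquare u=\bigwedge\{\blacksquare o\mid o\in O(A^\delta),\ u\leq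 o\}$. $\mathbb{S}^*\models\phi\leq\psi$ means that the inequality holds in $A^\delta$ for all values in $A$ of the variables $a,b$; an equality means both inequalities. Left (resp. right) self-adjoint: $\neg a\leq b\Leftrightarrow\neg b\leq a$ (resp. $a\leq\neg b\Leftrightarrow b\leq\neg a$) for all $a,b\in A$. In the left self-adjoint case $\neg$ is extended to $A^\delta$ by $\neg o=\bigwedge\{\neg a\mid a\in A,\ a\leq o\}$ for $o\in O(A^\delta)$ and $\neg u=\bigvee\{\neg o\mid o\in O(A^\delta),\ u\leq o\}$ for $u\in A^\delta$; in the right self-adjoint case by $\neg k=\bigvee\{\neg a\mid a\in A,\ k\leq a\}$ for $k\in K(A^\delta)$ and $\neg u=\bigwedge\{\neg k\mid k\in K(A^\delta),\ k\leq u\}$ for $u\in A^\delta$.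
   Formalization: In (iv)(b) the ''iff'' assumes every ≺[a] nonempty, in (vii)(a)–(c) every ≺⁻¹[a] nonempty, as it fails otherwise; without this only (SL2)⇒ineq., (S9⇒)⇒ineq., ineq.⇒(S9⇐), (SL1)⇒ineq. are claimed. *)

(* Defs.v *)
From HB Require Import structures.
From mathcomp Require Import all_boot all_order.
From mathcomp Require Import boolp classical_sets.

Set Implicit Arguments.
Unset Strict Implicit.
Unset Printing Implicit Defensive.

Import Order.TTheory.
Local Open Scope classical_set_scope.
Local Open Scope order_scope.

Section ProtoSubordination.
Context {d : Order.disp_t} {A : porderType d}.
Variable prec : A -> A -> Prop.
Local Notation "a ≺ b" := (prec a b) (at level 70, no associativity).

Definition SI := forall a b x, a <= b -> b ≺ x -> a ≺ x.
Definition WO := forall b x y, b ≺ x -> x <= y -> b ≺ y.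
Definition DD := forall a x1 x2, a ≺ x1 -> a ≺ x2 ->
  exists x, [/\ a ≺ x, x <= x1 & x <= x2].
Definition UD := forall a1 a2 x, a1 ≺ x -> a2 ≺ x ->
  exists a, [/\ a ≺ x, a1 <= a & a2 <= a].
Definition T := forall a b c, a ≺ b -> b ≺ c -> a ≺ c.
Definition D := forall a c, a ≺ c -> exists b, a ≺ b /\ b ≺ c.

(* DD and UD hold vacuously where ≺[a], resp. ≺^-1[a], is empty, and dia a, resp.
   box a, is then the new top, resp. bottom, of the canonical extension. These
   two conditions exclude that. *)
Definition serial := forall a, exists b, a ≺ b.
Definition coserial := forall b, exists a, a ≺ b.

Definition directed := [/\ SI, WO, UD & DD].

(* The operations on A are arguments; that they compute meets, joins, etc. is
   assumed where the conditions are used. *)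
Variables (meet join : A -> A -> A) (neg : A -> A).

Definition CT := forall a b c, a ≺ b -> meet a b ≺ c -> a ≺ c.
Definition S6 := forall a b, a ≺ b -> neg b ≺ neg a.
Definition S9_lhs a b x := exists c, c ≺ b /\ x ≺ join a c.
Definition S9_rhs a b x :=
  exists a' b', [/\ a' ≺ a, b' ≺ b & x <= join a' b'].
Definition S9_imp := forall a b x, S9_lhs a b x -> S9_rhs a b x.
Definition S9_conv := forall a b x, S9_rhs a b x -> S9_lhs a b x.
Definition SL1 := forall a b c, a ≺ join b c ->
  exists b' c', [/\ b' ≺ b, c' ≺ c & a ≺ join b' c'].
Definition SL2 := forall a b c, meet b c ≺ a ->
  exists b' c', [/\ b ≺ b', c ≺ c' & meet b' c' ≺ a].

Definition is_meet_of (a b m : A) := infimums [set a; b] m.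
Definition is_join_of (a b j : A) := supremums [set a; b] j.
Definition meet_semilattice := forall a b, is_meet_of a b (meet a b).
Definition join_semilattice := forall a b, is_join_of a b (join a b).

Definition antitone := forall a b, a <= b -> neg b <= neg a.
Definition left_self_adjoint := forall a b, neg a <= b <-> neg b <= a.
Definition right_self_adjoint := forall a b, a <= neg b <-> b <= neg a.

End ProtoSubordination.

(* The empty set is both down-directed and up-directed. So the top and bottom of
   a canonical extension are closed and open, respectively, and, by compactness,
   are not in the image of A. *)
Definition down_directed d (A : porderType d) (B : set A) :=
  forall a b, B a -> B b -> exists x, [/\ B x, x <= a & x <= b].
Definition up_directed d (A : porderType d) (B : set A) :=
  forall a b, B a -> B b -> exists x, [/\ B x, a <= x & b <= x].

Section Lattice.
Context {d : Order.disp_t} {L : tbLatticeType d}.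

(* supremum and infimum return their first argument on the empty set, so these
   are the join and the meet of every set when L is complete. *)
Definition Join (E : set L) : L := supremum \bot E.
Definition Meet (E : set L) : L := infimum \top E.

Definition complete_lattice :=
  forall E : set L, supremums E !=set0 /\ infimums E !=set0.

End Lattice.
Arguments complete_lattice {d} L.

Section CanonicalExtension.
Context {d : Order.disp_t} {A : porderType d}.
Context {dL : Order.disp_t} {L : tbLatticeType dL}.
Variable e : A -> L.

Definition closed_elt (k : L) :=
  exists2 F : set A, down_directed F & k = Meet (e @` F).
Definition open_elt (o : L) :=
  exists2 I : set A, up_directed I & o = Join (e @` I).

Definition dense := forall u : L,
  (exists2 E : set L, E `<=` closed_elt & u = Join E) /\
  (exists2 E : set L, E `<=` open_elt & u = Meet E).

Definition compact := forall F I : set A,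
  down_directed F -> up_directed I -> Meet (e @` F) <= Join (e @` I) ->
  exists a b, [/\ F a, I b & a <= b].

(* The inclusion of A in its canonical extension is an order embedding e. *)
Definition canonical_extension :=
  [/\ complete_lattice L, {mono e : x y / x <= y}, dense & compact].

Variable prec : A -> A -> Prop.

Definition dia (a : A) : L := Meet [set e b | b in [set b | prec a b]].
Definition box (a : A) : L := Join [set e b | b in [set b | prec b a]].

(* dia_ext agrees with diaK on closed elements and, under SI, with dia on A;
   dually for box_ext under WO. *)
Definition diaK (k : L) : L := Meet [set dia a | a in [set a | k <= e a]].
Definition dia_ext (u : L) : L :=
  Join [set diaK k | k in [set k | closed_elt k /\ k <= u]].
Definition boxO (o : L) : L := Join [set box a | a in [set a | e a <= o]].
Definition box_ext (u : L) : L :=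
  Meet [set boxO o | o in [set o | open_elt o /\ u <= o]].

Variable neg : A -> A.

Definition negO (o : L) : L := Meet [set e (neg a) | a in [set a | e a <= o]].
Definition neg_left (u : L) : L :=
  Join [set negO o | o in [set o | open_elt o /\ u <= o]].
Definition negK (k : L) : L := Join [set e (neg a) | a in [set a | k <= e a]].
Definition neg_right (u : L) : L :=
  Meet [set negK k | k in [set k | closed_elt k /\ k <= u]].

End CanonicalExtension.

(* Main.v *)
Require Import Defs.
From HB Require Import structures.
From mathcomp Require Import all_boot all_order.
From mathcomp Require Import boolp classical_sets.

Set Implicit Arguments.
Unset Strict Implicit.
Unset Printing Implicit Defensive.

Import Order.TTheory.
Local Open Scope classical_set_scope.
Local Open Scope order_scope.

(** A closed element [k] of a canonical extension is determined by the filter of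
    those [b] in [A] with [k <= e b] ([closed_le]), so an inequality between
    closed elements is an inclusion of filters. Compactness computes the filter
    of each closed element that occurs:
    - under WO and DD, [dia a] is closed and its filter is the set of all [b]
      with [prec a b] ([dia_leE]);
    - under SI, WO and DD, if [k] is closed, then so is [dia_ext k], and its
      filter is the image under [prec] of the filter of [k] ([dia_ext_leE]);
    - if [A] is a meet-semilattice, a meet of two closed elements is closed and
      its filter is generated by the two filters ([closedI_leE]).
    After these translations both sides of each equivalence are first-order
    statements about [prec], and they follow from each other by the monotonicity
    of [prec].

    The filter generated by two filters consists of the elements above a meet of
    a member of each, and of the members of either filter. The latter count only
    if the other filter is empty, that is, for filters of the form
    [{b | prec a b}], if [prec] does not relate [a] to anything. Then the
    inequality and the condition on [prec] can differ, which is why some of the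
    implications assume seriality or coseriality.

    An extended negation [Neg] exchanges closed and open elements, and
    [e b <= Neg k] iff [k <= e (neg b)] ([neg_extension]). So [Neg (dia a)] and
    [box (neg a)] are both open; [e b] is below the first iff [prec a (neg b)],
    and below the second iff [prec b (neg a)]. (S6) says that these conditions
    agree.

    Statements about [box] and open elements are those about [dia] and closed
    elements, for the dual orders [A^d] and [L^d] and the converse of [prec]. By
    conversion, this duality exchanges the two kinds of operations and elements,
    as well as [neg_left] and [neg_right]. *)

(** * Closed elements as filters *)

Section MeetsInCompleteLattices.
Context {d : Order.disp_t} {L : tbLatticeType d}.
Hypothesis hC : complete_lattice L.

(** The default value of [infimum] makes [Meet] correct on the empty set too. *)
Lemma Meet_infimum (E : set L) : infimums E (Meet E).
Proof.
have [_ [m mE]] := hC E; rewrite /Meet /infimum; case: ifPn => [/eqP ->|_].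
  by split=> // x _; exact: lex1.
by case: xgetP => [y -> //|/(_ m)].
Qed.

Lemma le_Meet (E : set L) u : u <= Meet E <-> forall x, E x -> u <= x.
Proof.
have [mE mG] := Meet_infimum E; split=> [uE x /mE|]; last exact: mG.
exact: le_trans.
Qed.

Lemma le_Meet_image T (f : T -> L) (B : set T) u :
  u <= Meet [set f b | b in B] <-> forall b, B b -> u <= f b.
Proof.
rewrite le_Meet; split=> [uB b Bb|uB _ [b Bb <-]]; last exact: uB.
by apply: uB; exists b.
Qed.

Lemma Meet_image_le T (f : T -> L) (B : set T) b :
  B b -> Meet [set f b | b in B] <= f b.
Proof. by move: b; apply/le_Meet_image. Qed.

End MeetsInCompleteLattices.

Section JoinsInCompleteLattices.
Context {d : Order.disp_t} {L : tbLatticeType d}.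
Hypothesis hC : complete_lattice L.

Let hCd : complete_lattice L^d. Proof. by move=> E; have [] := hC E. Qed.

Lemma Join_le (E : set L) u : Join E <= u <-> forall x, E x -> x <= u.
Proof. exact: (le_Meet hCd). Qed.

Lemma Join_image_le T (f : T -> L) (B : set T) u :
  Join [set f b | b in B] <= u <-> forall b, B b -> f b <= u.
Proof. exact: (le_Meet_image hCd). Qed.

Lemma le_Join_image T (f : T -> L) (B : set T) b :
  B b -> f b <= Join [set f b | b in B].
Proof. exact: (Meet_image_le hCd). Qed.

End JoinsInCompleteLattices.

Section MeetSemilattices.
Context {d : Order.disp_t} {A : porderType d}.
Variable meet : A -> A -> A.
Hypothesis meetP : meet_semilattice meet.

Lemma meet_leL a b : meet a b <= a.
Proof. by case: (meetP a b) => + _; apply; left. Qed.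

Lemma meet_leR a b : meet a b <= b.
Proof. by case: (meetP a b) => + _; apply; right. Qed.

Lemma le_meet a b c : c <= a -> c <= b -> c <= meet a b.
Proof. by move=> ca cb; case: (meetP a b) => _; apply=> _ [] ->. Qed.

Lemma meet_mono a a' b b' : a <= a' -> b <= b' -> meet a b <= meet a' b'.
Proof.
move=> aa' bb'; apply: le_meet.
  exact: le_trans (meet_leL a b) aa'.
exact: le_trans (meet_leR a b) bb'.
Qed.

End MeetSemilattices.

Section ClosedElements.
Context {d dL : Order.disp_t} {A : porderType d} {L : tbLatticeType dL}.
Variable e : A -> L.
Hypothesis hL : canonical_extension e.

Let hC : complete_lattice L. Proof. by case: hL. Qed.
Let eM : {mono e : x y / x <= y}. Proof. by case: hL. Qed.

Lemma le_embedding u v :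
  (forall k, closed_elt e k -> k <= u -> k <= v) -> u <= v.
Proof.
case: hL => _ _ eD _; have [[E EK ->] _] := eD u => uv.
apply/(Join_le hC) => k Ek; apply: uv; first exact: EK.
exact: (Join_le hC E _).1 (lexx _) k Ek.
Qed.

Lemma closed_embed a : closed_elt e (e a).
Proof.
exists [set a]; first by move=> _ _ -> ->; exists a.
apply/eqP; rewrite eq_le; apply/andP; split.
  by apply/(le_Meet_image hC) => _ ->.
exact: (Meet_image_le hC).
Qed.

Lemma closed_le_open k o : closed_elt e k -> open_elt e o -> k <= o ->
  exists2 a, k <= e a & e a <= o.
Proof.
case=> F dF -> [I dI ->] FI; case: hL => _ _ _ /(_ F I dF dI FI).
move=> [a [b [Fa Ib ab]]]; exists a; first exact: (Meet_image_le hC).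
by apply: (le_trans (y := e b)); [rewrite eM | exact: (le_Join_image hC)].
Qed.

(** Compactness, applied to the up-directed singleton of [b]. *)
Lemma Meet_directed_le (F : set A) b : down_directed F ->
  Meet [set e a | a in F] <= e b <-> exists2 a, F a & a <= b.
Proof.
move=> dF; split=> [Fb|[a Fa ab]]; last first.
  by apply: le_trans (_ : e a <= _); [exact: (Meet_image_le hC) | rewrite eM].
case: hL => _ _ _ /(_ F [set b] dF) [||a [_ [Fa -> ab]]]; last by exists a.
  by move=> _ _ -> ->; exists b.
by apply: le_trans Fb _; exact: (le_Join_image hC).
Qed.

(** Below two members of the filter of [k] there are two members of any directed
    set presenting [k], by compactness, and the latter have a common lower bound
    in that set. *)
Lemma closed_filter k : closed_elt e k -> down_directed [set a | k <= e a].
Proof.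
case=> F dF -> a b /= /(Meet_directed_le _ dF)[a' Fa' a'a].
move=> /(Meet_directed_le _ dF)[b' Fb' b'b].
have [c [Fc ca cb]] := dF _ _ Fa' Fb'; exists c; split=> /=.
- exact: (Meet_image_le hC).
- exact: le_trans a'a.
- exact: le_trans b'b.
Qed.

Lemma closed_le k u :
  closed_elt e k -> (forall b, k <= e b -> u <= e b) -> u <= k.
Proof.
case=> F _ -> uF; apply/(le_Meet_image hC) => b Fb.
exact/uF/(Meet_image_le hC).
Qed.

Lemma closed_eq k k' : closed_elt e k -> closed_elt e k' ->
  (forall b, k <= e b <-> k' <= e b) -> k = k'.
Proof.
move=> kK kK' kk'; apply/eqP; rewrite eq_le; apply/andP.
by split; apply: closed_le => // b /kk'.
Qed.

(** Closed elements join-generate [L], and by compactness a closed lower bound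
    of [e a] and [e b] lies below [e c] for some common lower bound [c] in [A].
    So existing binary meets of [A] are preserved by the embedding. *)
Lemma embed_meet a b m : is_meet_of a b m -> e a `&` e b = e m.
Proof.
case=> mab mG; apply/eqP; rewrite eq_le lexI !eM !mab /=; try by [left|right].
rewrite andbT; apply: le_embedding => k kK; rewrite lexI => /andP[ka kb].
have [c /= [kc ca cb]] := closed_filter kK ka kb.
by apply: le_trans kc _; rewrite eM; apply: mG => _ [] ->.
Qed.

Section ClosedMeets.
Variable meet : A -> A -> A.
Hypothesis meetP : meet_semilattice meet.

(** The filter generated by two filters, either of which may be empty. *)
Let meet_filter (k1 k2 : L) : set A := [set x | [\/ k1 <= e x, k2 <= e x |
  exists b1 b2, [/\ k1 <= e b1, k2 <= e b2 & meet b1 b2 <= x]]].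

(** A common lower bound of two members of one of the filters is taken in that
    filter; members of different filters have their meet in the generated one. *)
Let meet_filter_directed k1 k2 :
  closed_elt e k1 -> closed_elt e k2 -> down_directed (meet_filter k1 k2).
Proof.
move=> /closed_filter d1 /closed_filter d2.
have mM := meet_mono meetP; have [mL mR] := (meet_leL meetP, meet_leR meetP).
have sym x y : (exists z, [/\ meet_filter k1 k2 z, z <= y & z <= x]) ->
    exists z, [/\ meet_filter k1 k2 z, z <= x & z <= y].
  by case=> z [? ? ?]; exists z.
have mix x1 x2 : k1 <= e x1 -> k2 <= e x2 ->
    exists z, [/\ meet_filter k1 k2 z, z <= x1 & z <= x2].
  move=> kx1 kx2; exists (meet x1 x2); split=> //.
  by apply: Or33; exists x1, x2.
have mix1 x1 a b y : k1 <= e x1 -> k1 <= e a -> k2 <= e b -> meet a b <= y ->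
    exists z, [/\ meet_filter k1 k2 z, z <= x1 & z <= y].
  move=> kx ka kb ab; have [c /= [kc cx ca]] := d1 _ _ kx ka.
  exists (meet c b); split; first by apply: Or33; exists c, b.
    exact: le_trans cx.
  by apply: le_trans ab; exact: mM.
have mix2 x2 a b y : k2 <= e x2 -> k1 <= e a -> k2 <= e b -> meet a b <= y ->
    exists z, [/\ meet_filter k1 k2 z, z <= x2 & z <= y].
  move=> kx ka kb ab; have [c /= [kc cx cb]] := d2 _ _ kx kb.
  exists (meet a c); split; first by apply: Or33; exists a, c.
    exact: le_trans cx.
  by apply: le_trans ab; exact: mM.
move=> x y [kx|kx|[a [b [ka kb abx]]]] [ky|ky|[a' [b' [ka' kb' aby]]]].
- by have [z [? ? ?]] := d1 _ _ kx ky; exists z; split=> //; exact: Or31.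
- exact: mix.
- exact: mix1 ka' kb' aby.
- by apply: sym; exact: mix.
- by have [z [? ? ?]] := d2 _ _ kx ky; exists z; split=> //; exact: Or32.
- exact: mix2 ka' kb' aby.
- by apply: sym; exact: mix1 ka kb abx.
- by apply: sym; exact: mix2 ka kb abx.
- have [a2 /= [ka2 a2a a2a']] := d1 _ _ ka ka'.
  have [b2 /= [kb2 b2b b2b']] := d2 _ _ kb kb'.
  exists (meet a2 b2); split; first by apply: Or33; exists a2, b2.
    by apply: le_trans abx; exact: mM.
  by apply: le_trans aby; exact: mM.
Qed.

Let closedI_Meet k1 k2 : closed_elt e k1 -> closed_elt e k2 ->
  k1 `&` k2 = Meet [set e x | x in meet_filter k1 k2].
Proof.
move=> kK1 kK2; apply/eqP; rewrite eq_le; apply/andP; split.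
  apply/(le_Meet_image hC) => x [kx|kx|[a [b [ka kb abx]]]].
  - exact: leIxl.
  - exact: leIxr.
  - apply: le_trans (_ : e (meet a b) <= _); last by rewrite eM.
    by rewrite -(embed_meet (meetP a b)) leI2.
rewrite lexI; apply/andP; split; apply: closed_le => // b kb;
  by apply: (Meet_image_le hC); (exact: Or31 || exact: Or32).
Qed.

Lemma closedI k1 k2 :
  closed_elt e k1 -> closed_elt e k2 -> closed_elt e (k1 `&` k2).
Proof.
move=> kK1 kK2; exists (meet_filter k1 k2); first exact: meet_filter_directed.
exact: closedI_Meet.
Qed.

Lemma closedI_leE k1 k2 x : closed_elt e k1 -> closed_elt e k2 ->
  k1 `&` k2 <= e x <-> [\/ k1 <= e x, k2 <= e x |
    exists b1 b2, [/\ k1 <= e b1, k2 <= e b2 & meet b1 b2 <= x]].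
Proof.
move=> kK1 kK2; rewrite (closedI_Meet kK1 kK2).
have dM := meet_filter_directed kK1 kK2.
split=> [/(Meet_directed_le _ dM)[y fy yx]|fx]; last first.
  exact: (Meet_image_le hC).
case: fy => [ky|ky|[a [b [ka kb aby]]]].
- by apply: Or31; apply: le_trans ky _; rewrite eM.
- by apply: Or32; apply: le_trans ky _; rewrite eM.
- by apply: Or33; exists a, b; split=> //; exact: le_trans yx.
Qed.

End ClosedMeets.

(** * The diamond of a subordination *)

Section Diamond.
Variable prec : A -> A -> Prop.

(** [k] is the greatest closed element below [k], and [diaK] is monotone. *)
Lemma dia_ext_closedE k : closed_elt e k -> dia_ext e prec k = diaK e prec k.
Proof.
move=> kK; apply/eqP; rewrite eq_le; apply/andP; split.
  apply/(Join_image_le hC) => k' [_ k'k].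
  apply/(le_Meet_image hC) => a ka; apply: (Meet_image_le hC).
  exact: le_trans ka.
exact: (le_Join_image hC).
Qed.

Lemma subrelation_dia :
  (forall a b, prec a b -> a <= b) <-> (forall a, e a <= dia e prec a).
Proof.
split=> [pl a|pl a b ab].
  by apply/(le_Meet_image hC) => b /pl; rewrite eM.
by rewrite -eM; apply: le_trans (pl a) _; exact: (Meet_image_le hC).
Qed.

Hypothesis hDD : DD prec.

Let prec_directed a : down_directed [set b | prec a b].
Proof. by move=> x y ax ay; exact: hDD ax ay. Qed.

Lemma closed_dia a : closed_elt e (dia e prec a).
Proof. by exists [set b | prec a b]. Qed.

Hypothesis hWO : WO prec.

Lemma dia_leE a b : dia e prec a <= e b <-> prec a b.
Proof.
rewrite (Meet_directed_le _ (@prec_directed a)); split=> [[x ax xb]|ab].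
  exact: hWO ax xb.
by exists b.
Qed.

Lemma dia_le_reflexive :
  (forall a b, a <= b -> prec a b) <-> (forall a, dia e prec a <= e a).
Proof.
split=> [lp a|di a b]; first exact/dia_leE/lp.
by apply: hWO; exact/dia_leE.
Qed.

Hypothesis hSI : SI prec.

(** For closed [k] this is the filter of [dia_ext e prec k]. *)
Let dia_filter (k : L) : set A := [set c | exists2 b, k <= e b & prec b c].

Let dia_filter_directed k : closed_elt e k -> down_directed (dia_filter k).
Proof.
move=> /closed_filter dk x y [b kb bx] [c kc cy].
have [f /= [kf fb fc]] := dk _ _ kb kc.
have [z [fz zx zy]] := hDD (hSI fb bx) (hSI fc cy).
by exists z; split=> //; exists f.
Qed.

Let diaK_Meet k : diaK e prec k = Meet [set e c | c in dia_filter k].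
Proof.
apply/eqP; rewrite eq_le; apply/andP; split.
  apply/(le_Meet_image hC) => c [b kb /dia_leE bc].
  by apply: le_trans bc; exact: (Meet_image_le hC).
apply/(le_Meet_image hC) => b kb; apply/(le_Meet_image hC) => c bc.
by apply: (Meet_image_le hC); exists b.
Qed.

Lemma closed_dia_ext k : closed_elt e k -> closed_elt e (dia_ext e prec k).
Proof.
move=> kK; rewrite (dia_ext_closedE kK) diaK_Meet.
by exists (dia_filter k) => //; exact: dia_filter_directed.
Qed.

Lemma dia_ext_leE k c : closed_elt e k ->
  dia_ext e prec k <= e c <-> exists2 b, k <= e b & prec b c.
Proof.
move=> kK; rewrite (dia_ext_closedE kK) diaK_Meet.
rewrite (Meet_directed_le _ (dia_filter_directed kK)).
split=> [[x [b kb bx] xc]|kc]; last by exists c.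
by exists b => //; exact: hWO xc.
Qed.

Lemma transitive_dia :
  T prec <-> (forall a, dia e prec a <= dia_ext e prec (dia e prec a)).
Proof.
split=> [tr a|di a b c ab bc].
  apply: closed_le => [|c]; first exact/closed_dia_ext/closed_dia.
  move=> /(dia_ext_leE _ (closed_dia a))[b /dia_leE ab bc].
  exact/dia_leE/(tr _ _ _ ab bc).
apply/dia_leE/(le_trans (di a))/(dia_ext_leE _ (closed_dia a)).
by exists b => //; exact/dia_leE.
Qed.

Lemma interpolation_dia :
  D prec <-> (forall a, dia_ext e prec (dia e prec a) <= dia e prec a).
Proof.
split=> [dn a|di a c /dia_leE ac].
  apply: closed_le => [|c /dia_leE /dn[b [ab bc]]]; first exact: closed_dia.
  by apply/(dia_ext_leE _ (closed_dia a)); exists b => //; exact/dia_leE.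
have /(dia_ext_leE _ (closed_dia a)) := le_trans (di a) ac.
by case=> b /dia_leE ab bc; exists b.
Qed.

Section MeetSemilattice.
Variable meet : A -> A -> A.
Hypothesis meetP : meet_semilattice meet.

(** Of the three ways to be above [e a `&` dia e prec b], being above
    [dia e prec b] alone is absorbed by the last: if [prec b y], then
    [meet a y <= y]. *)
Lemma dia_meet_embed_leE a b c :
  dia_ext e prec (e a `&` dia e prec b) <= e c <->
  prec a c \/ exists2 x, prec b x & prec (meet a x) c.
Proof.
have aK := closed_embed a; have dK := closed_dia b.
rewrite (dia_ext_leE _ (closedI meetP aK dK)).
split=> [[y + yc]|[ac|[x bx axc]]].
- case/(closedI_leE meetP _ aK dK).
  + by rewrite eM => ay; left; exact: hSI yc.
  + move=> /dia_leE yb; right; exists y => //.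
    exact: hSI (meet_leR meetP a y) yc.
  + move=> [a' [x [+ /dia_leE bx xy]]]; rewrite eM => aa'.
    right; exists x => //; apply: hSI yc; apply: le_trans xy.
    exact: meet_mono.
- by exists a => //; rewrite leIxl.
- exists (meet a x) => //; rewrite -(embed_meet (meetP a x)) leI2 //.
  exact/dia_leE.
Qed.

Lemma cumulative_transitive_dia : CT prec meet <->
  (forall a, dia e prec a <= dia_ext e prec (e a `&` dia e prec a)).
Proof.
split=> [ct a|di a b c ab abc]; last first.
  apply/dia_leE/(le_trans (di a))/dia_meet_embed_leE.
  by right; exists b.
apply: closed_le.
  exact: closed_dia_ext (closedI meetP (closed_embed a) (closed_dia a)).
move=> c /dia_meet_embed_leE[ac|[b ab abc]]; apply/dia_leE => //.
exact: ct ab abc.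
Qed.

Let dia_meet_ineq := forall a b,
  dia_ext e prec (dia e prec a `&` dia e prec b) <= dia e prec (meet a b).

Lemma SL2_dia : SL2 prec meet -> dia_meet_ineq.
Proof.
move=> sl a b; apply: closed_le => [|c]; first exact: closed_dia.
move=> /dia_leE /sl[a' [b' [/dia_leE aa' /dia_leE bb' abc]]].
apply/(dia_ext_leE _ (closedI meetP (closed_dia a) (closed_dia b))).
by exists (meet a' b') => //; rewrite -(embed_meet (meetP a' b')) leI2.
Qed.

(** If only one of [dia a] and [dia b] lies below [e x], seriality supplies the
    missing successor of the other element. *)
Lemma dia_SL2 : serial prec -> dia_meet_ineq -> SL2 prec meet.
Proof.
move=> ser di c a b /dia_leE /(le_trans (di a b)).
have [aK bK] := (closed_dia a, closed_dia b).
case/(dia_ext_leE _ (closedI meetP aK bK)) => x.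
case/(closedI_leE meetP _ aK bK) => [/dia_leE ax|/dia_leE bx|].
- have [y bY] := ser b => xc; exists x, y; split=> //.
  exact: hSI (meet_leL meetP x y) xc.
- have [y aY] := ser a => xc; exists y, x; split=> //.
  exact: hSI (meet_leR meetP y x) xc.
- move=> [a' [b' [/dia_leE aa' /dia_leE bb' abx]]] xc; exists a', b'.
  by split=> //; exact: hSI abx xc.
Qed.

End MeetSemilattice.
End Diamond.

End ClosedElements.

(** * Order duality *)

Section Duality.
Context {d dL : Order.disp_t} {A : porderType d} {L : tbLatticeType dL}.
Variables (e : A -> L) (prec : A -> A -> Prop).

Lemma canonical_extension_dual :
  canonical_extension e -> @canonical_extension _ A^d _ L^d e.
Proof.
case=> hC eM eD eK; split.
- by move=> E; have [] := hC E.
- by move=> x y; exact: eM.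
- by move=> u; have [] := eD u.
- move=> F I dF dI FI.
  by have [a [b [Ia Fb ab]]] := eK I F dI dF FI; exists b, a; split.
Qed.

Let precd (a b : A^d) := prec b a.

Lemma DD_dual : UD prec -> DD precd.
Proof. by move=> hUD x a1 a2; exact: hUD. Qed.

Lemma UD_dual : DD prec -> UD precd.
Proof. by move=> hDD x1 x2 a; exact: hDD. Qed.

Lemma SI_dual : WO prec -> SI precd.
Proof. by move=> hWO y x b xy bx; exact: hWO bx xy. Qed.

Lemma WO_dual : SI prec -> WO precd.
Proof. by move=> hSI x b a bx ab; exact: hSI ab bx. Qed.

End Duality.

(** * Negation *)

Section Negation.
Context {d dL : Order.disp_t} {A : porderType d} {L : tbLatticeType dL}.
Variable e : A -> L.

(** An extension of a negation that exchanges closed and open elements, and that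
    moves across inequalities with elements of [A] as an antitone involution of
    [A] does. This is what [neg_left] and [neg_right] have in common. *)
Definition neg_extension (neg : A -> A) (Neg : L -> L) :=
  (forall k, closed_elt e k ->
    open_elt e (Neg k) /\ forall b, e b <= Neg k <-> k <= e (neg b)) /\
  (forall o, open_elt e o ->
    closed_elt e (Neg o) /\ forall b, Neg o <= e b <-> e (neg b) <= o).

(** By compactness, an open element above a closed [k] may be replaced by some
    [e a] in between, so [neg_left e neg k] is a join of elements of [A]. *)
Lemma neg_left_extension (neg : A -> A) :
  canonical_extension e -> antitone neg -> involutive neg ->
  neg_extension neg (neg_left e neg).
Proof.
move=> hL neg_anti negK; have hL' := canonical_extension_dual hL.
have [hC eM _ _] := hL.
have negC a b : a <= neg b -> b <= neg a by move=> /neg_anti; rewrite negK.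
(* [o] itself is the least open element above [o], and [negO] is antitone. *)
have negE o : open_elt e o -> neg_left e neg o = negO e neg o.
  move=> oO; apply/eqP; rewrite eq_le; apply/andP; split; last first.
    exact: (le_Join_image hC).
  apply/(Join_image_le hC) => o' [_ oo']; apply/(le_Meet_image hC) => a ao.
  by apply: (Meet_image_le hC); exact: le_trans oo'.
split=> [k kK|o oO].
  have up : up_directed [set b | k <= e (neg b)].
    move=> a b /= ka kb; have [c /= [kc ca cb]] := closed_filter hL kK ka kb.
    by exists (neg c); split=> /=; [rewrite negK | exact: negC | exact: negC].
  have negkE : neg_left e neg k = Join [set e b | b in [set b | k <= e (neg b)]].
    apply/eqP; rewrite eq_le; apply/andP; split.
      apply/(Join_image_le hC) => o [oO /(closed_le_open hL kK oO)[a ka ao]].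
      apply: le_trans (_ : e (neg a) <= _); first exact: (Meet_image_le hC).
      by apply: (le_Join_image hC); rewrite /= negK.
    apply/(Join_image_le hC) => b kb.
    apply: le_trans (_ : negO e neg (e (neg b)) <= _).
      by apply/(le_Meet_image hC) => a /=; rewrite !eM; exact: negC.
    by apply: (le_Join_image hC); split=> //; exact: (closed_embed hL' (neg b)).
  split; first by rewrite negkE; exists [set b | k <= e (neg b)].
  move=> b; rewrite negkE; split=> [|kb]; last exact: (le_Join_image hC).
  move=> /(Meet_directed_le hL' _ up)[c kc bc].
  by apply: le_trans kc _; rewrite eM; exact: neg_anti.
have imgE : [set e (neg a) | a in [set a | e a <= o]] =
    [set e b | b in [set b | e (neg b) <= o]].
  apply/seteqP; split=> _ [a /= ao <-]; exists (neg a) => //=; rewrite negK //.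
have down : down_directed [set b | e (neg b) <= o].
  move=> a b /= oa ob; have [c /= [oc ac bc]] := closed_filter hL' oO oa ob.
  exists (neg c); split=> /=; first by rewrite negK.
    by rewrite -[a]negK; exact: neg_anti.
  by rewrite -[b]negK; exact: neg_anti.
rewrite (negE o oO) /negO imgE; split.
  by exists [set b | e (neg b) <= o].
move=> b; rewrite (Meet_directed_le hL _ down); split=> [[c co cb]|bo].
  by apply: le_trans co; rewrite eM; exact: neg_anti.
by exists b.
Qed.

(** Both sides of the equation are open, so it is enough to compare the elements
    of [A] below them. The equation for [box] is the order dual of this one. *)
Lemma S6_dia (prec : A -> A -> Prop) (neg : A -> A) (Neg : L -> L) :
  canonical_extension e -> directed prec -> involutive neg ->
  neg_extension neg Neg ->
  S6 prec neg <-> (forall a, Neg (dia e prec a) = box e prec (neg a)).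
Proof.
move=> hL [hSI hWO hUD hDD] negK [Nclosed _].
have hL' := canonical_extension_dual hL.
have [hWO' hDD'] := (WO_dual hSI, DD_dual hUD).
have boxP a b : e b <= box e prec a <-> prec b a := dia_leE hL' hDD' hWO' a b.
have NdiaP a b : e b <= Neg (dia e prec a) <-> prec a (neg b).
  have [_ ->] := Nclosed _ (closed_dia e hDD a).
  exact: dia_leE.
split=> [s6 a|NE a b ab]; last first.
  by apply/boxP; rewrite -NE; apply/NdiaP; rewrite negK.
have [NO _] := Nclosed _ (closed_dia e hDD a).
apply: (closed_eq hL' NO (closed_dia _ hDD' _)) => b.
apply: iff_trans (NdiaP a b) (iff_trans _ (iff_sym (boxP (neg a) b))).
by split=> /s6; rewrite negK.
Qed.

End Negation.

(** * The box on a join-semilattice *)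

Section BoxOfJoins.
Context {d dL : Order.disp_t} {A : porderType d} {L : tbLatticeType dL}.
Variables (e : A -> L) (prec : A -> A -> Prop) (join : A -> A -> A).
Hypothesis hL : canonical_extension e.
Hypotheses (hSI : SI prec) (hUD : UD prec) (hWO : WO prec).
Hypothesis joinP : join_semilattice join.

Local Notation bx := (box e prec).
Local Notation Bx := (box_ext e prec).

Let hL' := canonical_extension_dual hL.
Let hDD' := DD_dual hUD.
Let hSI' := SI_dual hWO.
Let hWO' := WO_dual hSI.
Let joinP' : @meet_semilattice _ A^d join := joinP.

Let join_leL a b : a <= join a b. Proof. exact: (meet_leL joinP'). Qed.
Let join_leR a b : b <= join a b. Proof. exact: (meet_leR joinP'). Qed.

Lemma le_boxE a b : e b <= bx a <-> prec b a.
Proof. exact: (dia_leE hL' hDD' hWO'). Qed.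

Let box_open a : @closed_elt _ A^d _ L^d e (bx a) := closed_dia _ hDD' a.

Lemma le_box_extE a b c : e c <= Bx (e a `|` bx b) <->
  prec c a \/ exists2 x, prec x b & prec c (join a x).
Proof. exact: (dia_meet_embed_leE hL' hDD' hWO' hSI' joinP'). Qed.

Lemma le_box_joinE a b c : e c <= bx a `|` bx b <->
  [\/ prec c a, prec c b |
      exists a' b', [/\ prec a' a, prec b' b & c <= join a' b']].
Proof.
apply: iff_trans (closedI_leE hL' joinP' c (box_open a) (box_open b)) _.
split=> [[ca|cb|[a' [b' []]]]|[ca|cb|[a' [b' []]]]].
- by apply: Or31; exact/le_boxE.
- by apply: Or32; exact/le_boxE.
- by move=> /le_boxE ? /le_boxE ? ?; apply: Or33; exists a', b'.
- by apply: Or31; exact/le_boxE.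
- by apply: Or32; exact/le_boxE.
- by move=> /le_boxE ? /le_boxE ? ?; apply: Or33; exists a', b'.
Qed.

Lemma S9_imp_box :
  S9_imp prec join -> forall a b, Bx (e a `|` bx b) <= bx a `|` bx b.
Proof.
move=> s9 a b; apply: (closed_le hL').
  exact: (closed_dia_ext hL' hDD' hWO' hSI'
    (closedI hL' joinP' (closed_embed hL' a) (box_open b))).
move=> c /le_box_extE[ca|[x xb cax]]; apply/le_box_joinE; first exact: Or31.
by apply/Or33/s9; exists x.
Qed.

Lemma box_S9_imp : coserial prec ->
  (forall a b, Bx (e a `|` bx b) <= bx a `|` bx b) -> S9_imp prec join.
Proof.
move=> ser ia a b x [c [cb xac]].
have /le_box_joinE[xa|xb|//] : e x <= bx a `|` bx b.
  by apply: le_trans (ia a b); apply/le_box_extE; right; exists c.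
- by exists x, c; split.
- by have [a' a'a] := ser a; exists a', x; split.
Qed.

Lemma box_S9_conv :
  (forall a b, bx a `|` bx b <= Bx (e a `|` bx b)) -> S9_conv prec join.
Proof.
move=> ib a b x [a' [b' [a'a b'b xab]]].
have /le_box_extE[xa|[c cb xac]] : e x <= Bx (e a `|` bx b).
  by apply: le_trans (ib a b); apply/le_box_joinE/Or33; exists a', b'.
- by exists b'; split=> //; exact: hWO xa (join_leL a b').
- by exists c.
Qed.

(** An element below only one of the two boxes is below a join [join a' b'] with
    [prec a' a] and [prec b' b]: coseriality supplies the other member. *)
Lemma S9_conv_box : coserial prec ->
  S9_conv prec join -> forall a b, bx a `|` bx b <= Bx (e a `|` bx b).
Proof.
move=> ser s9 a b.
have below (c a' b' : A) : prec a' a -> prec b' b -> c <= join a' b' ->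
    e c <= Bx (e a `|` bx b).
  move=> a'a b'b cab; apply/le_box_extE; right.
  have [|x [xb cax]] := s9 a b c; last by exists x.
  by exists a', b'.
apply: (closed_le hL') => [|c].
  exact: (closedI hL' joinP' (box_open a) (box_open b)).
case/le_box_joinE => [ca|cb|[a' [b' [a'a b'b]]]]; last exact: below.
- by have [b' b'b] := ser b; exact: below ca b'b (join_leL _ _).
- by have [a' a'a] := ser a; exact: below a'a cb (join_leR _ _).
Qed.

Lemma SL1_box :
  SL1 prec join -> forall a b, bx (join a b) <= Bx (bx a `|` bx b).
Proof.
by move=> sl; apply: (SL2_dia hL' hDD' hWO' hSI' joinP') => a b c; exact: sl.
Qed.

Lemma box_SL1 : coserial prec ->
  (forall a b, bx (join a b) <= Bx (bx a `|` bx b)) -> SL1 prec join.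
Proof.
move=> ser ic a b c ab.
exact: (dia_SL2 hL' hDD' hWO' hSI' joinP' ser ic ab).
Qed.

End BoxOfJoins.

(** * The correspondence *)

Theorem proposition3p7 (d dL : Order.disp_t) (A : porderType d)
    (L : tbLatticeType dL) (e : A -> L) (prec : A -> A -> Prop)
    (hL : canonical_extension e) :
  let dm := dia e prec in
  let bx := box e prec in
  let Dm := dia_ext e prec in
  let Bx := box_ext e prec in
  (* (i) *)
  [/\ ((forall a b, prec a b -> a <= b) <-> (forall a, e a <= dm a)) /\
      ((forall a b, prec a b -> a <= b) <-> (forall a, bx a <= e a)),
  (* (ii) *)
      WO prec -> DD prec ->
      ((forall a b, a <= b -> prec a b) <-> (forall a, dm a <= e a)),
  (* (iii) *)
      WO prec -> DD prec -> SI prec ->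
      (T prec <-> (forall a, dm a <= Dm (dm a))) /\
      (D prec <-> (forall a, Dm (dm a) <= dm a)),
  (* (iv) *)
      forall meet : A -> A -> A, meet_semilattice meet ->
      WO prec -> DD prec -> SI prec ->
      let ineq := forall a b, Dm (dm a `&` dm b) <= dm (meet a b) in
      [/\ CT prec meet <-> (forall a, dm a <= Dm (e a `&` dm a)),
          SL2 prec meet -> ineq &
          serial prec -> (SL2 prec meet <-> ineq)] &
  [/\
  (* (v) *)
      forall meet : A -> A -> A,
      (forall a b, prec a b -> is_meet_of a b (meet a b)) ->
      SI prec -> CT prec meet -> T prec,
  (* (vi) *)
      forall (neg : A -> A) (Neg : L -> L),
      directed prec -> antitone neg -> involutive neg ->
      left_self_adjoint neg /\ Neg = neg_left e neg \/
      right_self_adjoint neg /\ Neg = neg_right e neg ->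
      [/\ S6 prec neg <-> (forall a, Neg (dm a) = bx (neg a)),
          S6 prec neg -> (forall a, bx a = Neg (dm (neg a))),
          S6 prec neg <-> (forall a, dm (neg a) = Neg (bx a)) &
          S6 prec neg -> (forall a, dm a = Neg (bx (neg a)))] &
  (* (vii) *)
      forall join : A -> A -> A, join_semilattice join ->
      SI prec -> UD prec -> WO prec ->
      let ineq_a := forall a b, Bx (e a `|` bx b) <= bx a `|` bx b in
      let ineq_b := forall a b, bx a `|` bx b <= Bx (e a `|` bx b) in
      let ineq_c := forall a b, bx (join a b) <= Bx (bx a `|` bx b) in
      [/\ S9_imp prec join -> ineq_a,
          ineq_b -> S9_conv prec join,
          SL1 prec join -> ineq_c &
          coserial prec ->
          [/\ S9_imp prec join <-> ineq_a,
              S9_conv prec join <-> ineq_b &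
              SL1 prec join <-> ineq_c]]]].
Proof.
move=> dm bx Dm Bx; have hL' := canonical_extension_dual hL.
split; first split.
- exact: subrelation_dia.
- have := subrelation_dia hL' (fun a b => prec b a).
  by move=> <-; split=> pl a b; exact: pl.
- by move=> hWO hDD; exact: dia_le_reflexive.
- by move=> hWO hDD hSI; split; [exact: transitive_dia | exact: interpolation_dia].
- move=> meet meetP hWO hDD hSI ineq; split.
  + exact: cumulative_transitive_dia.
  + exact: SL2_dia.
  + by move=> ser; split; [exact: SL2_dia | exact: dia_SL2].
split.
- move=> meet meetP hSI ct a b c ab bc; apply: (ct a b) => //.
  by apply: hSI bc; have [+ _] := meetP a b ab; apply; right.
- move=> neg Neg prec_dir neg_anti negK NegE.
  have Next : neg_extension e neg Neg.
    case: NegE => [] [_ ->]; first exact: neg_left_extension.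
    have neg_anti' : @antitone _ A^d neg by move=> a b; exact: neg_anti.
    by have [] := neg_left_extension hL' neg_anti' negK.
  have prec_dir' : @directed _ A^d (fun a b => prec b a).
    case: prec_dir => hSI hWO hUD hDD.
    by split; [exact: SI_dual | exact: WO_dual | exact: UD_dual | exact: DD_dual].
  have s6_dia := S6_dia hL prec_dir negK Next.
  have s6_box : S6 prec neg <-> (forall a, dm (neg a) = Neg (bx a)).
    have Next' : @neg_extension _ _ A^d L^d e neg Neg by case: Next.
    have := S6_dia hL' prec_dir' negK Next'.
    move=> [s6E Es6]; split=> [s6 a|E a b].
      by apply/esym/s6E => x y; exact: s6.
    by apply: Es6 => x; rewrite -E.
  split=> //.
  + by move=> /s6_dia E a; rewrite E negK.
  + by move=> /s6_box E a; rewrite -E negK.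
move=> join joinP hSI hUD hWO ineq_a ineq_b ineq_c.
have s9i : S9_imp prec join -> ineq_a by exact: S9_imp_box.
have s9c : ineq_b -> S9_conv prec join by exact: box_S9_conv.
have sl1 : SL1 prec join -> ineq_c by exact: SL1_box.
split=> // ser; split; split=> //.
- exact: box_S9_imp.
- exact: S9_conv_box.
- exact: box_SL1.
Qed.
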